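(* Let $\mathbf U=\langle\langle U,\approx\rangle,\preceq\rangle$ be a completely lattice $\mathbf L$-ordered set and $\sim$ a complete $\mathbf L$-tolerance on $\mathbf U$. For each $u\in U$, the class $[u]_\sim$ is equal to the $\mathbf L$-interval $[\![u_\sim,u^\sim]\!]$.
   Context: $\mathbf L=\langle L,\wedge,\vee,\otimes,\to,0,1\rangle$ is a complete residuated lattice ($\langle L,\wedge,\vee,0,1\rangle$ complete lattice, $\langle L,\otimes,1\rangle$ commutative monoid, $a\otimes b\le c$ iff $a\le b\to c$). An $\mathbf L$-set in $X$ is a map $X\to L$; $L^X$ the set of them; $S(A,B)=\bigwedge_x(A(x)\to B(x))$. An $\mathbf L$-equality is a binary $\mathbf L$-relation that is reflexive, symmetric, transitive ($R(x,y)\otimes R(y,z)\le R(x,z)$) and with $R(x,y)=1\Rightarrow x=y$. An $\mathbf L$-ordered set is $\langle\langle U,\approx\rangle,\preceq\rangle$, $\approx$ an $\mathbf L$-equality, $\preceq$ reflexive, transitive, compatible with $\approx$ ($(u\preceq v)\otimes(u\approx u')\otimes(v\approx v')\le(u'\preceq v')$), and $(u\preceq v)\wedge(v\preceq u)\le u\approx v$; $u\le v$ means $(u\preceq v)=1$. For $V\in L^U$: $\mathcal L V(v)=\bigwedge_u(V(u)\to(v\preceq u))$, $\mathcal U V(v)=\bigwedge_u(V(u)\to(u\preceq v))$; $\inf V$ is the unique $u$ with $\mathcal L V(u)=1=\mathcal U(\mathcal L V)(u)$, $\sup V$ the unique $u$ with $\mathcal U V(u)=1=\mathcal L(\mathcal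 U V)(u)$; completely lattice means these exist for all $V$. For $v\le u$, $[\![v,u]\!](w)=(v\preceq w)\wedge(w\preceq u)$. Power relation: for $R$ on $X$, $A,B\in L^X$, $(R\circ B)(x)=\bigvee_y R(x,y)\otimes B(y)$, $(A\circ R)(y)=\bigvee_x A(x)\otimes R(x,y)$, $R^+(A,B)=S(A,R\circ B)\wedge S(B,A\circ R)$. A binary $\mathbf L$-relation $R$ on $\mathbf U$ is complete if it is compatible with $\approx$ ($R(u,v)\otimes(u\approx u')\otimes(v\approx v')\le R(u',v')$) and $R^+(V_1,V_2)\le R(\inf V_1,\inf V_2)$, $R^+(V_1,V_2)\le R(\sup V_1,\sup V_2)$ for all $V_1,V_2\in L^U$. An $\mathbf L$-tolerance is a reflexive symmetric binary $\mathbf L$-relation. For $u\in U$, the class $[u]_\sim\in L^U$ is $[u]_\sim(v)=u\sim v$, and $u_\sim=\inf[u]_\sim$, $u^\sim=\sup[u]_\sim$. *)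

(* Defs.v *)
From HB Require Import structures.
From mathcomp Require Import all_boot all_order.
From mathcomp Require Import boolp classical_sets.

Set Implicit Arguments.
Unset Strict Implicit.
Unset Printing Implicit Defensive.

Import Order.TTheory.
Local Open Scope classical_set_scope.
Local Open Scope order_scope.

(* The lattice bounds 0 and 1 are [\bot] and [\top]; they may coincide. *)
HB.mixin Record isCompleteResiduated d L of Order.TBLattice d L := {
  bigmeet : set L -> L;
  bigjoin : set L -> L;
  bigmeetP : forall A : set L, infimums A (bigmeet A);
  bigjoinP : forall A : set L, supremums A (bigjoin A);
  tens : L -> L -> L;
  resid : L -> L -> L;
  tensA : associative tens;
  tensC : commutative tens;
  tens1x : left_id (\top : L) tens;
  adjointness : forall a b c : L, (tens a b <= c) = (a <= resid b c)
}.

#[short(type="completeResiduatedLatticeType")]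
HB.structure Definition CompleteResiduatedLattice d :=
  { L of Order.TBLattice d L & isCompleteResiduated d L }.

Notation "a \ox b" := (tens a b) (at level 40, left associativity).
Notation "a \imp b" := (resid a b) (at level 55, right associativity).

Section LRelations.
Context {d : Order.disp_t} {L : completeResiduatedLatticeType d} {X : Type}.
Implicit Types (R E : X -> X -> L) (A B : X -> L).

Definition subsethood A B : L := bigmeet (range (fun x => A x \imp B x)).

Definition lreflexive R := forall x, R x x = \top.
Definition lsymmetric R := forall x y, R x y = R y x.
Definition ltransitive R := forall x y z, R x y \ox R y z <= R x z.

Definition lequality R :=
  [/\ lreflexive R, lsymmetric R, ltransitive R
    & forall x y, R x y = \top -> x = y].

Definition compatible E R :=
  forall u v u' v', R u v \ox E u u' \ox E v v' <= R u' v'.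

Definition ltolerance R := lreflexive R /\ lsymmetric R.

Definition preimg R B : X -> L :=
  fun x => bigjoin (range (fun y => R x y \ox B y)).

Definition postimg A R : X -> L :=
  fun y => bigjoin (range (fun x => A x \ox R x y)).

Definition power_rel R A B : L :=
  subsethood A (preimg R B) `&` subsethood B (postimg A R).

Definition lclass R u : X -> L := fun v => R u v.

End LRelations.

Record lorderedSet d (L : completeResiduatedLatticeType d) := LOrderedSet {
  lcarrier :> Type;
  leqv : lcarrier -> lcarrier -> L;
  lprec : lcarrier -> lcarrier -> L;
  leqv_equality : lequality leqv;
  lprec_refl : lreflexive lprec;
  lprec_trans : ltransitive lprec;
  lprec_compat : compatible leqv lprec;
  lprec_antisym : forall u v, lprec u v `&` lprec v u <= leqv u v
}.

Section LOrderedSets.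
Context {d : Order.disp_t} {L : completeResiduatedLatticeType d}.
Context {U : lorderedSet L}.
Implicit Types (V : U -> L) (u v w : U).

Definition lle u v : Prop := lprec u v = \top.

Definition lower_cone V : U -> L :=
  fun v => bigmeet (range (fun u => V u \imp lprec v u)).

Definition upper_cone V : U -> L :=
  fun v => bigmeet (range (fun u => V u \imp lprec u v)).

Definition is_linf V u :=
  lower_cone V u = \top /\ upper_cone (lower_cone V) u = \top.

Definition is_lsup V u :=
  upper_cone V u = \top /\ lower_cone (upper_cone V) u = \top.

(* An interval in the proper sense only when [lle v u]. *)
Definition linterval v u : U -> L := fun w => lprec v w `&` lprec w u.

Lemma cone_top (f : U -> L) (g : U -> L) u :
  bigmeet (range (fun w => f w \imp g w)) = \top -> f u = \top -> g u = \top.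
Proof.
move=> fg fu; apply/eqP; rewrite -le1x.
have [/(_ (f u \imp g u)) + _] := bigmeetP (range (fun w => f w \imp g w)).
by rewrite fg -adjointness tens1x fu; apply; exists u => //; rewrite fu.
Qed.

Lemma lle_antisym u v : lle u v -> lle v u -> u = v.
Proof.
move=> uv vu; have [_ _ _] := @leqv_equality _ _ U; apply.
by have := lprec_antisym u v; rewrite uv vu meetxx le1x => /eqP.
Qed.

Lemma is_linf_unique V u v : is_linf V u -> is_linf V v -> u = v.
Proof.
move=> [lu ulu] [lv ulv].
by apply: lle_antisym; [exact: cone_top ulv lu | exact: cone_top ulu lv].
Qed.

Lemma is_lsup_unique V u v : is_lsup V u -> is_lsup V v -> u = v.
Proof.
move=> [lu ulu] [lv ulv].
by apply: lle_antisym; [exact: cone_top ulu lv | exact: cone_top ulv lu].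
Qed.

End LOrderedSets.

Definition completely_lattice d (L : completeResiduatedLatticeType d)
    (U : lorderedSet L) : Prop :=
  (forall V : U -> L, exists u, is_linf V u) /\
  (forall V : U -> L, exists u, is_lsup V u).

Section InfSup.
Context {d : Order.disp_t} {L : completeResiduatedLatticeType d}.
Context {U : lorderedSet L} (hU : completely_lattice U).
Implicit Types (V : U -> L) (R : U -> U -> L).

Definition linf V : U := sval (cid (hU.1 V)).
Definition lsup V : U := sval (cid (hU.2 V)).

Lemma linfP V : is_linf V (linf V). Proof. exact: svalP (cid (hU.1 V)). Qed.
Lemma lsupP V : is_lsup V (lsup V). Proof. exact: svalP (cid (hU.2 V)). Qed.

Definition complete_lrel R :=
  [/\ compatible (@leqv _ _ U) R,
      forall V1 V2, power_rel R V1 V2 <= R (linf V1) (linf V2)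
    & forall V1 V2, power_rel R V1 V2 <= R (lsup V1) (lsup V2)].

End InfSup.

(* Main.v *)
(** Write p = inf {u, v} and q = sup {u, v}, let a be the degree of u_ below v
    and b that of v below u^.  Completeness applied to {u} and its class gives
    u ~ u_ and u ~ u^ to degree 1.  Meeting u ~ u^ with v gives p ~ v to degree
    b, since inf {u^, v} equals v to degree b; dually q ~ v to degree a, and
    meeting this with u gives u ~ p to degree a.  Joining p ~ v with u ~ p
    gives u ~ v to degree at least the meet of a and b, as p is below u and v. *)
Require Import Defs.
From mathcomp Require Import all_boot all_order.
From mathcomp Require Import boolp classical_sets.

Set Implicit Arguments.
Unset Strict Implicit.
Unset Printing Implicit Defensive.

Import Order.TTheory.
Local Open Scope order_scope.

Section ResiduatedLattice.
Context {d : Order.disp_t} {L : completeResiduatedLatticeType d}.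
Implicit Types a b c : L.

Lemma tensx1 a : a \ox \top = a.
Proof. by rewrite tensC tens1x. Qed.

Lemma tensx0 a : a \ox \bot = \bot.
Proof. by apply/eqP; rewrite -lex0 tensC adjointness le0x. Qed.

Lemma le_bigmeet_range T (f : T -> L) c :
  (forall x, c <= f x) -> c <= bigmeet (range f).
Proof. by move=> cf; apply: (bigmeetP _).2 => _ [x _ <-]. Qed.

Lemma bigmeet_range_le T (f : T -> L) x : bigmeet (range f) <= f x.
Proof. by apply: (bigmeetP (range f)).1; exists x. Qed.

Lemma le_bigjoin_range T (f : T -> L) x c : c <= f x -> c <= bigjoin (range f).
Proof.
by move=> /le_trans; apply; apply: (bigjoinP (range f)).1; exists x.
Qed.

Lemma le_subsethood T (A B : T -> L) c :
  (forall x, c \ox A x <= B x) -> c <= subsethood A B.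
Proof. by move=> cAB; apply: le_bigmeet_range => x; rewrite -adjointness. Qed.

(** A crisp pair, so that the completeness of [sim] can be used on binary meets and joins; with
    [x = y] it is the singleton. *)
Definition pair_set T (x y : T) : T -> L :=
  fun z => if `[< z = x \/ z = y >] then \top else \bot.

Lemma pair_setl T (x y : T) : pair_set x y x = \top.
Proof. by rewrite /pair_set asboolT //; left. Qed.

Lemma pair_setr T (x y : T) : pair_set x y y = \top.
Proof. by rewrite /pair_set asboolT //; right. Qed.

Lemma pair_set_le T (x y : T) (f : T -> L) c :
  c <= f x -> c <= f y -> forall z, c \ox pair_set x y z <= f z.
Proof.
move=> cx cy z; rewrite /pair_set; case: asboolP => [[]->|_].
- by rewrite tensx1.
- by rewrite tensx1.
- by rewrite tensx0 le0x.
Qed.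

(** The witness for [x] is [x'] and that for [y] is [y'], and conversely, so both halves of
    [power_rel] are at least [c]. *)
Lemma le_power_rel_pair T (R : T -> T -> L) x y x' y' c :
  c <= R x x' -> c <= R y y' ->
  c <= power_rel R (pair_set x y) (pair_set x' y').
Proof.
move=> cx cy; rewrite lexI; apply/andP; split; apply: le_subsethood.
- apply: pair_set_le.
  + by apply: (le_bigjoin_range (x := x')); rewrite pair_setl tensx1.
  + by apply: (le_bigjoin_range (x := y')); rewrite pair_setr tensx1.
- apply: pair_set_le.
  + by apply: (le_bigjoin_range (x := x)); rewrite pair_setl tens1x.
  + by apply: (le_bigjoin_range (x := y)); rewrite pair_setr tens1x.
Qed.

(** The point [x] lies in its class to degree [R x x], and each [y] is related to [x] exactly to its
    degree of membership in the class. *)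
Lemma power_rel_singleton_class T (R : T -> T -> L) x :
  R x x = \top -> power_rel R (pair_set x x) (lclass R x) = \top.
Proof.
move=> Rxx; apply/eqP; rewrite -le1x lexI; apply/andP; split.
- apply: le_subsethood; apply: pair_set_le;
  by apply: (le_bigjoin_range (x := x)); rewrite /lclass Rxx tens1x.
- apply: le_subsethood => y; apply: (le_bigjoin_range (x := x)).
  by rewrite pair_setl.
Qed.

End ResiduatedLattice.

Section CompletelyLattice.
Context {d : Order.disp_t} {L : completeResiduatedLatticeType d}.
Context {U : lorderedSet L} (hU : completely_lattice U).
Implicit Types (V : U -> L) (u v w x y z : U) (c : L).

Lemma linf_lb V x : V x <= lprec (linf hU V) x.
Proof.
have [lb _] := linfP hU V.
have := bigmeet_range_le (fun x => V x \imp lprec (linf hU V) x) x.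
by rewrite -[X in X <= _]/(lower_cone V (linf hU V)) lb -adjointness tens1x.
Qed.

Lemma lsup_ub V x : V x <= lprec x (lsup hU V).
Proof.
have [ub _] := lsupP hU V.
have := bigmeet_range_le (fun x => V x \imp lprec x (lsup hU V)) x.
by rewrite -[X in X <= _]/(upper_cone V (lsup hU V)) ub -adjointness tens1x.
Qed.

Lemma linf_glb V w c :
  (forall x, c \ox V x <= lprec w x) -> c <= lprec w (linf hU V).
Proof.
move=> cV; have [_ glb] := linfP hU V.
have := bigmeet_range_le (fun x => lower_cone V x \imp lprec x (linf hU V)) w.
rewrite -[X in X <= _]/(upper_cone (lower_cone V) (linf hU V)) glb.
rewrite -adjointness tens1x; apply: le_trans.
(* [lower_cone V w] is by definition the subsethood of [V] in [lprec w]. *)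
exact: (le_subsethood cV).
Qed.

Lemma lsup_lub V w c :
  (forall x, c \ox V x <= lprec x w) -> c <= lprec (lsup hU V) w.
Proof.
move=> cV; have [_ lub] := lsupP hU V.
have := bigmeet_range_le (fun x => upper_cone V x \imp lprec (lsup hU V) x) w.
rewrite -[X in X <= _]/(lower_cone (upper_cone V) (lsup hU V)) lub.
rewrite -adjointness tens1x; apply: le_trans.
exact: (le_subsethood (B := fun x => lprec x w) cV).
Qed.

Definition inf2 x y := linf hU (pair_set x y).
Definition sup2 x y := lsup hU (pair_set x y).

Lemma inf2l x y : lle (inf2 x y) x.
Proof. by apply/eqP; rewrite -le1x -(pair_setl x y) linf_lb. Qed.

Lemma inf2r x y : lle (inf2 x y) y.
Proof. by apply/eqP; rewrite -le1x -(pair_setr x y) linf_lb. Qed.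

Lemma sup2l x y : lle x (sup2 x y).
Proof. by apply/eqP; rewrite -le1x -(pair_setl x y) lsup_ub. Qed.

Lemma sup2r x y : lle y (sup2 x y).
Proof. by apply/eqP; rewrite -le1x -(pair_setr x y) lsup_ub. Qed.

Lemma le_inf2 w x y c :
  c <= lprec w x -> c <= lprec w y -> c <= lprec w (inf2 x y).
Proof. by move=> cx cy; apply: linf_glb; apply: pair_set_le. Qed.

Lemma sup2_le w x y c :
  c <= lprec x w -> c <= lprec y w -> c <= lprec (sup2 x y) w.
Proof.
by move=> cx cy; apply: lsup_lub; apply: (pair_set_le (f := fun x => lprec x w)).
Qed.

(** The meet lies below [y] to degree [\top], so antisymmetry leaves only the degree of [y] below
    the meet. *)
Lemma inf2_leqv x y : lprec y x <= leqv (inf2 x y) y.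
Proof.
apply: le_trans (lprec_antisym _ _).
by rewrite inf2r meet1x; apply: le_inf2; rewrite ?lprec_refl ?lex1.
Qed.

Lemma sup2_leqv x y : lprec x y <= leqv (sup2 x y) y.
Proof.
apply: le_trans (lprec_antisym _ _).
by rewrite sup2r meetx1; apply: sup2_le; rewrite ?lprec_refl ?lex1.
Qed.

Lemma inf2_idPr x y : lle y x -> inf2 x y = y.
Proof.
have [_ _ _ sep] := @leqv_equality _ _ U => yx; apply: sep.
by apply/eqP; rewrite -le1x -yx inf2_leqv.
Qed.

Lemma sup2_idPr x y : lle x y -> sup2 x y = y.
Proof.
have [_ _ _ sep] := @leqv_equality _ _ U => xy; apply: sep.
by apply/eqP; rewrite -le1x -xy sup2_leqv.
Qed.

Section CompleteTolerance.
Variables (sim : U -> U -> L).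
Hypotheses (sim_tol : ltolerance sim) (sim_complete : complete_lrel hU sim).

Lemma sim_inf2 x y x' y' c :
  c <= sim x x' -> c <= sim y y' -> c <= sim (inf2 x y) (inf2 x' y').
Proof.
have [_ infR _] := sim_complete => cx cy.
exact: le_trans (le_power_rel_pair cx cy) (infR _ _).
Qed.

Lemma sim_sup2 x y x' y' c :
  c <= sim x x' -> c <= sim y y' -> c <= sim (sup2 x y) (sup2 x' y').
Proof.
have [_ _ supR] := sim_complete => cx cy.
exact: le_trans (le_power_rel_pair cx cy) (supR _ _).
Qed.

(** Compatibility with [leqv] moves the right argument from [y] to [z] while [x] stays fixed. *)
Lemma sim_leqv x y z : sim x y = \top -> leqv y z <= sim x z.
Proof.
have [compat _ _] := sim_complete; have [refl _ _ _] := @leqv_equality _ _ U.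
by move=> xy; have := compat x y x z; rewrite xy refl !tens1x.
Qed.

Lemma sim_linf_class x : sim x (linf hU (lclass sim x)) = \top.
Proof.
have [_ infR _] := sim_complete.
have := infR (pair_set x x) (lclass sim x).
rewrite power_rel_singleton_class ?sim_tol.1 //.
(* The infimum of the singleton of [x] is [x] itself. *)
rewrite -/(inf2 x x) (inf2_idPr (lprec_refl x)).
by rewrite le1x => /eqP.
Qed.

Lemma sim_lsup_class x : sim x (lsup hU (lclass sim x)) = \top.
Proof.
have [_ _ supR] := sim_complete.
have := supR (pair_set x x) (lclass sim x).
rewrite power_rel_singleton_class ?sim_tol.1 //.
rewrite -/(sup2 x x) (sup2_idPr (lprec_refl x)).
by rewrite le1x => /eqP.
Qed.

(** Meeting [u ~ w] with [v ~ v] relates [inf2 u v] to [inf2 w v] fully, and the latter equals [v]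
    to degree [lprec v w]. Here [w] stands for the supremum of the class. *)
Lemma sim_inf2_upper u v w :
  sim u w = \top -> lprec v w <= sim (inf2 u v) v.
Proof.
move=> uw; apply: le_trans (inf2_leqv w v) _; apply: sim_leqv.
by apply/eqP; rewrite -le1x; apply: sim_inf2; rewrite ?uw ?sim_tol.1.
Qed.

Lemma sim_sup2_lower u v w :
  sim u w = \top -> lprec w v <= sim (sup2 u v) v.
Proof.
move=> uw; apply: le_trans (sup2_leqv w v) _; apply: sim_leqv.
by apply/eqP; rewrite -le1x; apply: sim_sup2; rewrite ?uw ?sim_tol.1.
Qed.

Lemma sim_inf2_lower u v w :
  sim u w = \top -> lprec w v <= sim u (inf2 u v).
Proof.
move=> uw.
(* Meeting [sup2 u v ~ v] with [u ~ u] yields [u] on the left by absorption and the meet of [u] and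
   [v] on the right. *)
have absorb : inf2 (sup2 u v) u = u by apply: inf2_idPr; apply: sup2l.
have comm : inf2 v u = inf2 u v.
  apply: lle_antisym; apply/eqP; rewrite -le1x; apply: le_inf2;
  by rewrite ?inf2l ?inf2r.
rewrite -[X in sim X _]absorb -comm.
by apply: sim_inf2; rewrite ?sim_tol.1 ?lex1 // sim_sup2_lower.
Qed.

Lemma linterval_sim u v lo hi :
  sim u lo = \top -> sim u hi = \top -> linterval lo hi v <= sim u v.
Proof.
move=> ulo uhi.
have -> : sim u v = sim (sup2 (inf2 u v) u) (sup2 (inf2 u v) v).
  by rewrite !sup2_idPr //; [apply: inf2r | apply: inf2l].
(* The swap lines up the arguments: the componentwise goals become [u ~ inf2 u v] and
   [inf2 u v ~ v], one for each half of the interval. *)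
have -> : sup2 (inf2 u v) u = sup2 u (inf2 u v).
  apply: lle_antisym; apply/eqP; rewrite -le1x; apply: sup2_le;
  by rewrite ?sup2l ?sup2r.
apply: sim_sup2.
- exact: le_trans (leIl _ _) (sim_inf2_lower _ ulo).
- exact: le_trans (leIr _ _) (sim_inf2_upper _ uhi).
Qed.

End CompleteTolerance.
End CompletelyLattice.

Theorem theorem13 (d : Order.disp_t) (L : completeResiduatedLatticeType d)
    (U : lorderedSet L) (hU : completely_lattice U) (sim : U -> U -> L)
    (sim_tol : ltolerance sim) (sim_complete : complete_lrel hU sim) (u : U) :
  lle (linf hU (lclass sim u)) (lsup hU (lclass sim u)) /\
  lclass sim u = linterval (linf hU (lclass sim u)) (lsup hU (lclass sim u)).
Proof.
have lo v : lclass sim u v <= lprec (linf hU (lclass sim u)) v by apply: linf_lb.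
have hi v : lclass sim u v <= lprec v (lsup hU (lclass sim u)) by apply: lsup_ub.
split.
  (* As a full member of its class, [u] lies between the two bounds, and transitivity compares
     them. *)
  have uu : lclass sim u u = \top by apply: sim_tol.1.
  have := lprec_trans (linf hU (lclass sim u)) u (lsup hU (lclass sim u)).
  have := lo u; have := hi u; rewrite uu !le1x => /eqP -> /eqP ->.
  by rewrite tens1x le1x => /eqP.
apply/funext => v; apply/eqP; rewrite eq_le; apply/andP; split.
  (* The class lies in the interval because its infimum and supremum bound it; the converse uses
     that both bounds are related to [u] to degree [\top]. *)
  by rewrite lexI lo hi.
apply: (linterval_sim sim_tol sim_complete).
- exact: sim_linf_class.
- exact: sim_lsup_class.
Qed.
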